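(* Consider the state-space model, the backward-factorized variational distributions, the functions $V_t^{\theta,\phi}$ and $r_{t+1}^{\theta,\phi}$, and the evidence lower bound $\mathcal{L}_t(\theta,\phi)$ defined in the context, under the regularity assumption stated there. Then for all $t\ge1$ $$\nabla_\theta\mathcal{L}_t(\theta,\phi)=\mathbb{E}_{q_t^\phi(x_t)}\left[S_t^{\theta,\phi}(x_t)\right],\qquad\text{where } S_t^{\theta,\phi}(x_t):=\nabla_\theta V_t^{\theta,\phi}(x_t).$$ Additionally, if we define $$s_{t+1}^\theta(x_t,x_{t+1}):=\nabla_\theta r_{t+1}^{\theta,\phi}(x_t,x_{t+1})=\nabla_\theta\log\big(f_\theta(x_{t+1}|x_t)\,g_\theta(y_{t+1}|x_{t+1})\big),$$ then for all $t\geq 1$ $$S_{t+1}^{\theta,\phi}(x_{t+1})=\mathbb{E}_{q_{t+1}^\phi(x_t|x_{t+1})}\left[S_t^{\theta,\phi}(x_t)+s_{t+1}^\theta(x_t,x_{t+1})\right].$$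
   Context: State-space model: states $x_t\in\mathbb{R}^{d_x}$, observations $y_t\in\mathcal{Y}$ (fixed), parameter $\theta\in\mathbb{R}^{d_\theta}$; $\mu_\theta(x_1)$ is the initial density, $f_\theta(x_{t+1}|x_t)$ the transition density and $g_\theta(y_t|x_t)$ the observation density. Write $y^t=(y_1,\dots,y_t)$ and $$p_\theta(x_{1:t},y^t)=\mu_\theta(x_1)g_\theta(y_1|x_1)\prod_{k=2}^t f_\theta(x_k|x_{k-1})g_\theta(y_k|x_k).$$ Variational family: for a variational parameter $\phi$ (not depending on $\theta$), one is given probability densities $q_t^\phi(x_t)$ on $\mathbb{R}^{d_x}$ ($t\ge1$) and conditional probability densities (backward kernels) $q_{k+1}^\phi(x_k|x_{k+1})$ ($k\ge1$), none of which depend on $\theta$. Define $$q_t^\phi(x_{1:t})=q_t^\phi(x_t)\prod_{k=1}^{t-1}q_{k+1}^\phi(x_k|x_{k+1}),\qquad q_t^\phi(x_{1:t-1}|x_t)=\prod_{k=1}^{t-1}q_{k+1}^\phi(x_k|x_{k+1}),$$ $$m_{t+1}^\phi(x_{t+1}|x_t):=\frac{q_{t+1}^\phi(x_t|x_{t+1})\,q_{t+1}^\phi(x_{t+1})}{q_t^\phi(x_t)}.$$ Evidence lower bound: $\mathcal{L}_t(\theta,\phi):=\mathbb{E}_{q_t^\phi(x_{1:t})}\left[\log\big(p_\theta(x_{1:t},y^t)/q_t^\phi(x_{1:t})\big)\right]$. Value function: $V_t^{\theta,\phi}(x_t):=\mathbb{E}_{q_t^\phi(x_{1:t-1}|x_t)}\left[\log\big(p_\theta(x_{1:t},y^t)/q_t^\phi(x_{1:t})\big)\right]$,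 with $V_1^{\theta,\phi}(x_1)=\log(p_\theta(x_1,y_1)/q_1^\phi(x_1))$. Reward: $r_{t+1}^{\theta,\phi}(x_t,x_{t+1}):=\log\big(f_\theta(x_{t+1}|x_t)g_\theta(y_{t+1}|x_{t+1})/m_{t+1}^\phi(x_{t+1}|x_t)\big)$ for $t\ge1$. Regularity assumption (standing): all densities are strictly positive, all displayed expectations (and those of each summand) are finite, the model densities are differentiable in $\theta$, and $\nabla_\theta$ may be interchanged with integration with respect to the variational distributions, i.e. with $\mathbb{E}_{q_t^\phi(x_{1:t})}$, $\mathbb{E}_{q_t^\phi(x_t)}$, $\mathbb{E}_{q_t^\phi(x_{1:t-1}|x_t)}$ and $\mathbb{E}_{q_{t+1}^\phi(x_t|x_{t+1})}$, of the functions $\log(p_\theta/q_t^\phi)$, $V_t^{\theta,\phi}$ and $r_{t+1}^{\theta,\phi}$ above. *)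

(* Defs.v *)
From HB Require Import structures.
From mathcomp Require Import all_boot all_order all_algebra.
From mathcomp Require Import all_classical all_reals all_analysis.

Set Implicit Arguments.
Unset Strict Implicit.
Unset Printing Implicit Defensive.

Import Order.TTheory GRing.Theory Num.Theory.
Import numFieldNormedType.Exports.

Local Open Scope classical_set_scope.
Local Open Scope ring_scope.

(** * Finite powers of a sigma-finite measure *)

Section rcons_measure.
Context d (T : measurableType d) (R : realType).
Variable mu : {sigma_finite_measure set T -> \bar R}.
Variables (n : nat) (m : {sigma_finite_measure set (n.-tuple T) -> \bar R}).

Definition rcons_pair (p : n.-tuple T * T) : n.+1.-tuple T :=
  [tuple of rcons p.1 p.2].

Lemma tnth_rcons_widen (w : n.-tuple T) (x : T) (i : 'I_n) :
  tnth [tuple of rcons w x] (widen_ord (leqnSn n) i) = tnth w i.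
Proof.
rewrite (tnth_nth x) (tnth_nth x)/= nth_rcons size_tuple.
by rewrite ltn_ord.
Qed.

Lemma tnth_rcons_max (w : n.-tuple T) (x : T) :
  tnth [tuple of rcons w x] ord_max = x.
Proof. by rewrite (tnth_nth x)/= nth_rcons size_tuple ltnn eqxx. Qed.

Lemma measurable_rcons_pair : measurable_fun [set: _] rcons_pair.
Proof.
apply/measurable_fun_tnthP => i.
have [ni|ni] := ltnP i n.
- rewrite (_ : _ \o _ = (fun w : n.-tuple T => tnth w (Ordinal ni)) \o fst).
    by apply: measurableT_comp => //; exact: measurable_tnth.
  apply/funext => -[w x] /=; rewrite -(tnth_rcons_widen w x (Ordinal ni)).
  by congr tnth; exact/val_inj.
- rewrite (_ : _ \o _ = snd)//; apply/funext => -[w x] /=.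
  rewrite -[RHS](tnth_rcons_max w x); congr tnth; apply/val_inj => /=.
  by apply/eqP; rewrite eqn_leq ni -ltnS ltn_ord.
Qed.

Definition rcons_measure : set (n.+1.-tuple T) -> \bar R :=
  pushforward (m \x mu)%E rcons_pair.

Let rcons_measure0 : rcons_measure set0 = 0%E.
Proof. by rewrite /rcons_measure /pushforward preimage_set0 measure0. Qed.

Let rcons_measure_ge0 A : (0 <= rcons_measure A)%E.
Proof. by rewrite /rcons_measure /pushforward measure_ge0. Qed.

Let rcons_measure_sigma_additive : semi_sigma_additive rcons_measure.
Proof.
move=> F mF tF mUF; rewrite /rcons_measure /pushforward preimage_bigcup.
apply: measure_semi_sigma_additive.
- move=> k; rewrite -[X in measurable X]setTI; exact: measurable_rcons_pair.
- apply/trivIsetP => /= i j _ _ ij; rewrite -preimage_setI.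
  by move/trivIsetP : tF => /(_ _ _ _ _ ij) ->//; rewrite preimage_set0.
- rewrite -preimage_bigcup -[X in measurable X]setTI.
  exact: measurable_rcons_pair.
Qed.

HB.instance Definition _ := isMeasure.Build _ _ _ rcons_measure
  rcons_measure0 rcons_measure_ge0 rcons_measure_sigma_additive.

Let unrcons (z : n.+1.-tuple T) : n.-tuple T * T :=
  ([tuple tnth z (widen_ord (leqnSn n) i) | i < n], tnth z ord_max).

Let rcons_pairK : cancel rcons_pair unrcons.
Proof.
move=> -[w x]; rewrite /unrcons tnth_rcons_max; congr pair.
by apply: eq_from_tnth => i; rewrite tnth_mktuple tnth_rcons_widen.
Qed.

Let measurable_unrcons : measurable_fun [set: _] unrcons.
Proof.
apply: measurable_fun_pair; last exact: measurable_tnth.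
apply/measurable_fun_tnthP => i.
rewrite (_ : _ \o _ = fun z => tnth z (widen_ord (leqnSn n) i)).
  exact: measurable_tnth.
by apply/funext => z /=; rewrite tnth_mktuple.
Qed.

Let rcons_measure_sigma_finite : sigma_finite setT rcons_measure.
Proof.
have /sigma_finiteP[F [TF ndF Foo]] := sigma_finiteT m.
have /sigma_finiteP[G [TG ndG Goo]] := sigma_finiteT mu.
exists (fun k => unrcons @^-1` (F k `*` G k)).
  rewrite predeqE => z; split=> // _.
  have [i _ Fi] : (\bigcup_i F i) (unrcons z).1 by rewrite -TF.
  have [j _ Gj] : (\bigcup_i G i) (unrcons z).2 by rewrite -TG.
  exists (maxn i j) => //; split.
    by move: Fi; exact/subsetPset/ndF/leq_maxl.
  by move: Gj; exact/subsetPset/ndG/leq_maxr.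
move=> k; have [mF Fk] := Foo k; have [mG Gk] := Goo k.
have mFG : measurable (F k `*` G k) by exact: measurableX.
split; first by rewrite -[X in measurable X]setTI; exact: measurable_unrcons.
rewrite /rcons_measure /pushforward.
rewrite (_ : _ @^-1` _ = F k `*` G k).
  by rewrite product_measure1E// lte_mul_pinfty// ge0_fin_numE.
by apply/funext => p; rewrite -[in RHS](rcons_pairK p).
Qed.

HB.instance Definition _ := Measure_isSigmaFinite.Build _ _ _ rcons_measure
  rcons_measure_sigma_finite.

End rcons_measure.

(* The n-fold product of mu on T^n, built by adding one coordinate on the
   right at a time; T^0 is a single point of mass 1. *)
Fixpoint power_measure d (T : measurableType d) (R : realType)
    (mu : {sigma_finite_measure set T -> \bar R}) (n : nat) :
    {sigma_finite_measure set (n.-tuple T) -> \bar R} :=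
  match n with
  | 0 => [the {sigma_finite_measure set (0.-tuple T) -> \bar R} of \d_[tuple]]
  | n'.+1 => [the {sigma_finite_measure set (n'.+1.-tuple T) -> \bar R} of
               rcons_measure mu (power_measure mu n')]
  end.


(* R^n as the measurable space of n-tuples of reals, with n-dimensional
   Lebesgue measure. *)
Notation euclidean R n := (n.-tuple (measurableTypeR R)).

Definition lebesgue_euclidean (R : realType) (n : nat) :
    {sigma_finite_measure set (euclidean R n) -> \bar R} :=
  power_measure
    [the {sigma_finite_measure set (measurableTypeR R) -> \bar R} of
      @lebesgue_measure R] n.

(** * Densities, expectations and gradients *)

Section density.
Context {d} {T : measurableType d} {R : realType}.
Variable mu : {measure set T -> \bar R}.

Definition prob_density (q : T -> R) : Prop :=
  [/\ measurable_fun [set: T] q, forall x, 0 <= q x &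
      (\int[mu]_x (q x)%:E = 1)%E].

(* k x u stands for the conditional density k(x | u). *)
Definition cond_density {d'} {U : measurableType d'} (k : T -> U -> R) : Prop :=
  measurable_fun [set: T * U] (fun z => k z.1 z.2) /\
  forall u, prob_density (k ^~ u).

Definition expect (q h : T -> R) : R := \int[mu]_x (q x * h x).

Definition expect_finite (q h : T -> R) : Prop :=
  mu.-integrable [set: T] (fun x => (q x * h x)%:E).

Definition expect_vec {p} (q : T -> R) (h : T -> 'rV[R]_p) : 'rV[R]_p :=
  \row_i expect q (fun x => h x 0 i).

Definition expect_vec_finite {p} (q : T -> R) (h : T -> 'rV[R]_p) : Prop :=
  forall i, expect_finite q (fun x => h x 0 i).

End density.

Section gradient.
Context {R : realType} {p : nat}.

Definition has_gradient (h : 'rV[R]_p -> R) (theta : 'rV[R]_p) : Prop :=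
  forall i : 'I_p, derivable h theta (delta_mx 0 i).

(* Total: meaningful only under has_gradient h theta. *)
Definition gradient (h : 'rV[R]_p -> R) (theta : 'rV[R]_p) : 'rV[R]_p :=
  \row_i 'D_(delta_mx 0 i) h theta.

(* The expectations of h and of its gradient under the density q are finite,
   and the gradient passes through the expectation. *)
Definition gradient_interchange {d} {T : measurableType d}
    (mu : {measure set T -> \bar R}) (q : T -> R)
    (h : 'rV[R]_p -> T -> R) : Prop :=
  forall theta,
    [/\ expect_finite mu q (h theta),
        expect_vec_finite mu q (fun x => gradient (h ^~ x) theta),
        has_gradient (fun theta' => expect mu q (h theta')) theta &
        gradient (fun theta' => expect mu q (h theta')) theta =
        expect_vec mu q (fun x => gradient (h ^~ x) theta)].

End gradient.

(** * State-space models and variational families *)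

(* Conditional densities take the value first and the conditioning variable
   second: ssm_trans theta x' x is f_theta(x' | x), ssm_obs theta y x is
   g_theta(y | x). *)
Record state_space_model (R : realType) (dx dth : nat) (dY : measure_display)
    (Y : measurableType dY) (nu : {measure set Y -> \bar R}) := StateSpaceModel {
  ssm_init : 'rV[R]_dth -> euclidean R dx -> R;
  ssm_trans : 'rV[R]_dth -> euclidean R dx -> euclidean R dx -> R;
  ssm_obs : 'rV[R]_dth -> Y -> euclidean R dx -> R;
  ssm_init_density : forall theta,
    prob_density (lebesgue_euclidean R dx) (ssm_init theta);
  ssm_trans_density : forall theta,
    cond_density (lebesgue_euclidean R dx) (ssm_trans theta);
  ssm_obs_density : forall theta, cond_density nu (ssm_obs theta) }.

(* Times start at 1, so the value of vf_marginal at 0 and those of vf_backward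
   at 0 and 1 are irrelevant. vf_backward t x x' is q_t(x | x'), with x the
   state at time t - 1 and x' the state at time t. *)
Record variational_family (R : realType) (dx : nat) := VariationalFamily {
  vf_marginal : nat -> euclidean R dx -> R;
  vf_backward : nat -> euclidean R dx -> euclidean R dx -> R;
  vf_marginal_density : forall t, (1 <= t)%N ->
    prob_density (lebesgue_euclidean R dx) (vf_marginal t);
  vf_backward_density : forall t, (1 <= t)%N ->
    cond_density (lebesgue_euclidean R dx) (vf_backward t.+1) }.

Section elbo.
Context {R : realType} {dx dth : nat} {dY : measure_display}
        {Y : measurableType dY} {nu : {measure set Y -> \bar R}}.
Variables (M : state_space_model dx dth nu) (q : variational_family R dx)
          (y : nat -> Y).
Local Notation X := (euclidean R dx).
Local Notation Theta := 'rV[R]_dth.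
Implicit Types (theta : Theta) (t : nat).

Local Notation init := (ssm_init M).
Local Notation f := (ssm_trans M).
Local Notation g := (ssm_obs M).
Local Notation marg := (vf_marginal q).
Local Notation back := (vf_backward q).

(* The 1-based trajectory k |-> x_k listed by s = [:: x_1; ...; x_t]; the
   values off {1, ..., t} are never used. *)
Definition trajectory (s : seq X) : nat -> X :=
  fun k => nth [tuple 0 | i < dx] s k.-1.

Definition joint_density theta t (x : nat -> X) : R :=
  init theta (x 1%N) * g theta (y 1%N) (x 1%N) *
  \prod_(2 <= k < t.+1) (f theta (x k) (x k.-1) * g theta (y k) (x k)).

(* q_t(x_{1:t-1} | x_t) *)
Definition backward_density t (x : nat -> X) : R :=
  \prod_(1 <= k < t) back k.+1 (x k) (x k.+1).

Definition path_density t (x : nat -> X) : R :=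
  marg t (x t) * backward_density t x.

Definition log_ratio theta t (x : nat -> X) : R :=
  ln (joint_density theta t x / path_density t x).

(* m_{t+1}(x' | x) *)
Definition forward_kernel t (x' x : X) : R :=
  back t.+1 x x' * marg t.+1 x' / marg t x.

(* Lebesgue measure on (R^dx)^n. *)
Definition path_measure n : {sigma_finite_measure set (n.-tuple X) -> \bar R} :=
  power_measure (lebesgue_euclidean R dx) n.

Definition ELBO t theta : R :=
  expect (path_measure t) (fun w => path_density t (trajectory w))
    (fun w => log_ratio theta t (trajectory w)).

Definition value t theta (x : X) : R :=
  expect (path_measure t.-1)
    (fun w => backward_density t (trajectory (rcons w x)))
    (fun w => log_ratio theta t (trajectory (rcons w x))).

(* For t = 1 the expectation is over the one-point space of empty paths. *)
Lemma value1E theta (x : X) :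
  value 1 theta x = ln (init theta x * g theta (y 1%N) x / marg 1 x).
Proof.
rewrite /value /expect /Rintegral (_ : (fun _ => _) =
    cst (log_ratio theta 1 (trajectory [:: x]))%:E); last first.
  apply/funext => w; rewrite tuple0/= /backward_density big_geq// mul1r.
  by [].
rewrite integral_dirac// diracT mul1e/=.
by rewrite /log_ratio /joint_density /path_density /backward_density
  !big_geq// !mulr1.
Qed.

(* r_{t+1}(x, x') *)
Definition reward t theta (x x' : X) : R :=
  ln (f theta x' x * g theta (y t.+1) x' / forward_kernel t x' x).

(* S_t(x) *)
Definition value_gradient t theta (x : X) : 'rV[R]_dth :=
  gradient (fun theta' => value t theta' x) theta.

(* s_{t+1}(x, x') *)
Definition reward_gradient t theta (x x' : X) : 'rV[R]_dth :=
  gradient (fun theta' => reward t theta' x x') theta.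

Definition positive_densities : Prop :=
  [/\ forall theta x, 0 < init theta x,
      forall theta x' x, 0 < f theta x' x,
      forall theta z x, 0 < g theta z x,
      forall t x, (1 <= t)%N -> 0 < marg t x &
      forall t x x', (1 <= t)%N -> 0 < back t.+1 x x'].

Definition differentiable_densities : Prop :=
  [/\ forall theta x, differentiable (fun theta' => init theta' x) theta,
      forall theta x' x, differentiable (fun theta' => f theta' x' x) theta &
      forall theta z x, differentiable (fun theta' => g theta' z x) theta].

Record regular : Prop := Regular {
  regular_positive : positive_densities;
  regular_differentiable : differentiable_densities;
  regular_path : forall t, (1 <= t)%N ->
    gradient_interchange (path_measure t) (fun w => path_density t (trajectory w))
      (fun theta w => log_ratio theta t (trajectory w));
  regular_marginal : forall t, (1 <= t)%N ->
    gradient_interchange (lebesgue_euclidean R dx) (marg t) (value t);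
  regular_value : forall t x, (1 <= t)%N ->
    gradient_interchange (path_measure t.-1)
      (fun w => backward_density t (trajectory (rcons w x)))
      (fun theta w => log_ratio theta t (trajectory (rcons w x)));
  regular_backward_value : forall t x', (1 <= t)%N ->
    gradient_interchange (lebesgue_euclidean R dx) (back t.+1 ^~ x') (value t);
  regular_backward_reward : forall t x', (1 <= t)%N ->
    gradient_interchange (lebesgue_euclidean R dx) (back t.+1 ^~ x')
      (fun theta x => reward t theta x x') }.

End elbo.

(* Main.v *)
(* Integrating the path x_{1:t} with the last state on the outside (Fubini)
   gives L_t = E_{q_t(x_t)}[V_t(x_t)]. As
   log (p_{t+1} / q_{t+1}) = log (p_t / q_t) + r_{t+1}(x_t, x_{t+1}) and the
   backward density of x_{1:t-1} given x_t integrates to 1, the same splitting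
   gives the Bellman recursion
   V_{t+1}(x_{t+1}) = E_{q_{t+1}(x_t | x_{t+1})}[V_t(x_t) + r_{t+1}(x_t, x_{t+1})].
   Both gradient identities follow by differentiating under the expectation;
   m_{t+1} does not depend on theta, so it drops out of the gradient of
   r_{t+1}. *)
Require Import Defs.
From mathcomp Require Import all_boot all_order all_algebra.
From mathcomp Require Import all_classical all_reals all_analysis.
From mathcomp Require Import measurable_realfun ring.

Import Order.TTheory GRing.Theory Num.Theory.
Import numFieldNormedType.Exports.

Local Open Scope classical_set_scope.
Local Open Scope ring_scope.

(** * Integration over paths with the last state split off *)

Lemma integrable_rcons_pair (d : measure_display) (T : measurableType d)
    (R : realType) (mu : {sigma_finite_measure set T -> \bar R}) (n : nat)
    (m : {sigma_finite_measure set (n.-tuple T) -> \bar R})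
    (f : n.+1.-tuple T -> \bar R) :
  (rcons_measure mu m).-integrable [set: _] f ->
  (m \x mu)%E.-integrable [set: _] (f \o @rcons_pair d T n).
Proof.
move=> /integrableP[mf fi]; apply/integrableP; split.
  exact: (measurableT_comp mf (@measurable_rcons_pair d T n)).
move: fi; rewrite ge0_integral_pushforward//; last 2 first.
- exact: measurable_rcons_pair.
- exact: measurableT_comp.
Qed.

(** Fubini after pulling back along [rcons_pair]. Joint integrability makes slices integrable only
    for almost every [x]; asking it for all [x] lets [fine] be removed pointwise from the inner
    integral. *)
Lemma Rintegral_rcons_measure (d : measure_display) (T : measurableType d)
    (R : realType) (mu : {sigma_finite_measure set T -> \bar R}) (n : nat)
    (m : {sigma_finite_measure set (n.-tuple T) -> \bar R})
    (h : n.+1.-tuple T -> R) :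
  (rcons_measure mu m).-integrable [set: _] (EFin \o h) ->
  (forall x, m.-integrable [set: _] (fun w => (h [tuple of rcons w x])%:E)) ->
  \int[rcons_measure mu m]_z h z =
  \int[mu]_x \int[m]_w h [tuple of rcons w x].
Proof.
move=> hi hxi; have hpi := integrable_rcons_pair _ _ _ _ _ _ _ hi.
rewrite /Rintegral integral_pushforward//; last 2 first.
- exact: measurable_rcons_pair.
- by case/integrableP: hi.
rewrite -integral21_prod_meas1//; congr fine; apply: eq_integral => x _.
by rewrite fineK// integrable_fin_num//; exact: hxi.
Qed.

(** Tonelli counterpart, used to compute the mass of the backward density before its integrability
    is known. *)
Lemma ge0_integral_rcons_measure (d : measure_display) (T : measurableType d)
    (R : realType) (mu : {sigma_finite_measure set T -> \bar R}) (n : nat)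
    (m : {sigma_finite_measure set (n.-tuple T) -> \bar R})
    (f : n.+1.-tuple T -> \bar R) :
  measurable_fun [set: _] f -> (forall z, (0 <= f z)%E) ->
  (\int[rcons_measure mu m]_z f z =
   \int[mu]_x \int[m]_w f [tuple of rcons w x])%E.
Proof.
move=> mf f0; rewrite ge0_integral_pushforward//; last first.
  exact: measurable_rcons_pair.
rewrite fubini_tonelli2//; last by move=> p; exact: f0.
exact: (measurableT_comp mf (@measurable_rcons_pair d T n)).
Qed.

Lemma measurable_nth_rcons (d : measure_display) (T : measurableType d)
    (n : nat) (x0 x : T) (i : nat) :
  measurable_fun [set: n.-tuple T] (fun w : n.-tuple T => nth x0 (rcons w x) i).
Proof.
have [ni|ni] := ltnP i n.
  rewrite (_ : (fun _ => _) = (fun w => tnth w (Ordinal ni))).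
    exact: measurable_tnth.
  by apply/funext => w; rewrite nth_rcons size_tuple ni (tnth_nth x0).
(* Index [n] reads the appended [x] and larger ones the default [x0]: constant in [w] either way. *)
rewrite (_ : (fun _ => _) = cst (if i == n then x else x0))//.
by apply/funext => w; rewrite nth_rcons size_tuple ltnNge ni.
Qed.

Lemma trajectory_rcons (R : realType) (dx : nat) (s : seq (euclidean R dx))
    (x : euclidean R dx) (k : nat) :
  (k.-1 < size s)%N -> trajectory (rcons s x) k = trajectory s k.
Proof. by move=> ks; rewrite /trajectory nth_rcons ks. Qed.

Lemma trajectory_last (R : realType) (dx : nat) (s : seq (euclidean R dx))
    (x : euclidean R dx) (k : nat) :
  size s = k -> trajectory (rcons s x) k.+1 = x.
Proof. by move=> <-; rewrite /trajectory nth_rcons ltnn eqxx. Qed.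

(** * Linearity of gradients and expectations *)

Lemma derive_addr_cst (R : realType) (V : normedModType R) (h : V -> R) (c : R)
    (a v : V) :
  'D_v (fun x => h x + c) a = 'D_v h a.
Proof.
rewrite /derive; set F := (F in lim (F @ _)); set G := (G in _ = lim (G @ _)).
suff -> : F = G by [].
(* The constant cancels in every difference quotient, so both sides are limits of the same
   function. *)
by apply/funext => e; rewrite /F /= [h a + c]addrC addrKA.
Qed.

Lemma gradient_addr_cst (R : realType) (p : nat) (h : 'rV[R]_p -> R) (c : R)
    (theta : 'rV[R]_p) :
  gradient (fun theta' => h theta' + c) theta = gradient h theta.
Proof. by apply/rowP => i; rewrite !mxE derive_addr_cst. Qed.

Lemma gradientD (R : realType) (p : nat) (h k : 'rV[R]_p -> R)
    (theta : 'rV[R]_p) :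
  has_gradient h theta -> has_gradient k theta ->
  gradient (fun theta' => h theta' + k theta') theta =
  gradient h theta + gradient k theta.
Proof. by move=> dh dk; apply/rowP => i; rewrite !mxE deriveD. Qed.

Lemma expectD (d : measure_display) (T : measurableType d) (R : realType)
    (mu : {measure set T -> \bar R}) (q h k : T -> R) :
  expect_finite mu q h -> expect_finite mu q k ->
  expect mu q (fun x => h x + k x) = expect mu q h + expect mu q k.
Proof.
move=> hi ki; rewrite /expect -RintegralD//.
by apply: eq_Rintegral => x _; rewrite mulrDr.
Qed.

Lemma expect_vecD (d : measure_display) (T : measurableType d) (R : realType)
    (mu : {measure set T -> \bar R}) (p : nat) (q : T -> R)
    (h k : T -> 'rV[R]_p) :
  expect_vec_finite mu q h -> expect_vec_finite mu q k ->
  expect_vec mu q (fun x => h x + k x) = expect_vec mu q h + expect_vec mu q k.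
Proof.
move=> hi ki; apply/rowP => i; rewrite !mxE -expectD//.
by congr expect; apply/funext => x; rewrite mxE.
Qed.

(** * Recursions in time for the densities and the log ratio *)

Section recursion.
Context {R : realType} {dx dth : nat} {dY : measure_display}
        {Y : measurableType dY} {nu : {measure set Y -> \bar R}}.
Context (M : state_space_model dx dth nu) (q : variational_family R dx)
        (y : nat -> Y).
Local Notation X := (euclidean R dx).

Lemma joint_density_recr theta n (x : nat -> X) :
  joint_density M y theta n.+2 x = joint_density M y theta n.+1 x *
    (ssm_trans M theta (x n.+2) (x n.+1) * ssm_obs M theta (y n.+2) (x n.+2)).
Proof. by rewrite /joint_density big_nat_recr//= mulrA. Qed.

Lemma backward_density_recr n (x : nat -> X) :
  backward_density q n.+2 x =
  backward_density q n.+1 x * vf_backward q n.+2 (x n.+1) (x n.+2).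
Proof. by rewrite /backward_density big_nat_recr. Qed.

Lemma backward_density_rcons n (w : n.-tuple X) (x x' : X) :
  backward_density q n.+2 (trajectory (rcons (rcons w x) x')) =
  vf_backward q n.+2 x x' * backward_density q n.+1 (trajectory (rcons w x)).
Proof.
have sw : size (rcons w x) = n.+1 by rewrite size_rcons size_tuple.
(* Time [k] reads entry [k.-1], so times up to [n.+1] never see [x']; time 0 reads entry 0 as
   well. *)
have tr k : (k <= n.+1)%N ->
    trajectory (rcons (rcons w x) x') k = trajectory (rcons w x) k.
  by move=> kn; rewrite trajectory_rcons// sw; case: k kn.
rewrite backward_density_recr mulrC; congr (_ * _).
  by rewrite (trajectory_last _ _ _ _ _ sw) tr// trajectory_last//
    size_tuple.
rewrite /backward_density; apply: eq_big_nat => k /andP[k0 kn].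
by rewrite !tr// ltnW.
Qed.

Lemma measurable_backward_density n (x : X) :
  measurable_fun [set: n.-tuple X]
    (fun w : n.-tuple X => backward_density q n.+1 (trajectory (rcons w x))).
Proof.
rewrite /backward_density; apply: measurable_prod => k.
rewrite mem_index_iota => /andP[k1 _].
have [mk _] := vf_backward_density q k1.
have mnth := measurable_nth_rcons _ X n [tuple 0 | i < dx] x.
exact: (measurableT_comp mk (measurable_fun_pair (mnth k.-1) (mnth k))).
Qed.

Hypothesis pos : positive_densities M q.

Lemma backward_density_gt0 n (x : nat -> X) : 0 < backward_density q n.+1 x.
Proof.
have [_ _ _ _ b0] := pos.
rewrite /backward_density big_seq; apply: prodr_gt0 => k.
by rewrite mem_index_iota => /andP[k1 _]; exact: b0.
Qed.

(** Induction on the path length: with its last state [x0] fixed, the inner integral is 1 by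
    induction, leaving the kernel density of [x0] given [x]. For the empty path the measure is a
    Dirac mass and the product is empty. *)
Lemma integral_backward_density n (x : X) :
  (\int[path_measure n]_w
     (backward_density q n.+1 (trajectory (rcons w x)))%:E = 1)%E.
Proof.
elim: n x => [|n IH] x.
  rewrite integral_dirac//; last first.
    by apply/measurable_EFinP; exact: measurable_backward_density.
  by rewrite diracT mul1e /backward_density big_geq.
rewrite ge0_integral_rcons_measure; last 2 first.
- by apply/measurable_EFinP; exact: measurable_backward_density.
- by move=> z; rewrite lee_fin ltW// backward_density_gt0.
(* The target 1 is rewritten as the total mass of the kernel, so that integrands can be compared. *)
have [_ /(_ x)[_ _ <-]] := vf_backward_density q (t := n.+1) isT.
apply: eq_integral => x0 _.
under eq_integral do rewrite backward_density_rcons EFinM.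
rewrite ge0_integralZl//.
- by rewrite IH mule1.
- by apply/measurable_EFinP; exact: measurable_backward_density.
- by move=> w _; rewrite lee_fin ltW// backward_density_gt0.
- by have [_ _ _ _ b0] := pos; rewrite lee_fin ltW// b0.
Qed.

Lemma integrable_backward_density n (x : X) :
  (path_measure n).-integrable [set: _]
    (fun w => (backward_density q n.+1 (trajectory (rcons w x)))%:E).
Proof.
apply/integrableP; split.
  by apply/measurable_EFinP; exact: measurable_backward_density.
under eq_integral do rewrite gee0_abs ?lee_fin ?ltW ?backward_density_gt0//.
by rewrite integral_backward_density ltry.
Qed.

Lemma joint_density_gt0 theta n (x : nat -> X) :
  0 < joint_density M y theta n.+1 x.
Proof.
have [i0 f0 g0 _ _] := pos.
by rewrite /joint_density mulr_gt0 ?mulr_gt0//; apply: prodr_gt0 => k _;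
  rewrite mulr_gt0.
Qed.

Lemma path_density_gt0 n (x : nat -> X) : 0 < path_density q n.+1 x.
Proof.
have [_ _ _ m0 _] := pos.
by rewrite /path_density mulr_gt0 ?backward_density_gt0 ?m0.
Qed.

Lemma forward_kernel_gt0 n (x' x : X) : 0 < forward_kernel q n.+1 x' x.
Proof.
have [_ _ _ m0 b0] := pos.
by rewrite /forward_kernel divr_gt0 ?mulr_gt0 ?m0 ?b0.
Qed.

Lemma path_density_recr n (x : nat -> X) :
  path_density q n.+2 x =
  path_density q n.+1 x * forward_kernel q n.+1 (x n.+2) (x n.+1).
Proof.
have [_ _ _ m0 _] := pos; have m1 := lt0r_neq0 (m0 n.+1 (x n.+1) isT).
rewrite /path_density /forward_kernel backward_density_recr.
by field.
Qed.

(* p_{t+1} / q_{t+1} = (p_t / q_t) * f g / m_{t+1}, because m_{t+1} is defined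
   so that q_{t+1}(x_{1:t+1}) = q_t(x_{1:t}) * m_{t+1}. *)
Lemma log_ratio_recr theta n (x : nat -> X) :
  log_ratio M q y theta n.+2 x = log_ratio M q y theta n.+1 x +
    reward M q y n.+1 theta (x n.+1) (x n.+2).
Proof.
have [_ f0 g0 _ _] := pos.
rewrite [RHS]addrC /log_ratio /reward -lnM ?posrE; last 2 first.
- by rewrite divr_gt0 ?forward_kernel_gt0 ?mulr_gt0 ?f0 ?g0.
- by rewrite divr_gt0 ?joint_density_gt0 ?path_density_gt0.
by rewrite joint_density_recr path_density_recr invfM mulrACA mulrC.
Qed.

Lemma log_ratio_rcons theta n (w : n.-tuple X) (x x' : X) :
  log_ratio M q y theta n.+2 (trajectory (rcons (rcons w x) x')) =
  log_ratio M q y theta n.+1 (trajectory (rcons w x)) +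
    reward M q y n.+1 theta x x'.
Proof.
have sw : size (rcons w x) = n.+1 by rewrite size_rcons size_tuple.
have tr k : (k <= n.+1)%N ->
    trajectory (rcons (rcons w x) x') k = trajectory (rcons w x) k.
  by move=> kn; rewrite trajectory_rcons// sw; case: k kn.
have tl : trajectory (rcons w x) n.+1 = x.
  by rewrite trajectory_last// size_tuple.
rewrite log_ratio_recr tr// tl (trajectory_last _ _ _ _ _ sw); congr (_ + _).
(* The log ratio at time [n.+1] reads only times up to [n.+1], where both trajectories agree. *)
rewrite /log_ratio /joint_density /path_density /backward_density !tr//.
congr (ln (_ * _ / (_ * _))); apply: eq_big_nat => k /andP[k0 kn].
  by rewrite !tr//; case: k {k0} kn => //= k /ltnW.
by rewrite !tr// ltnW.
Qed.

End recursion.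

(** * The evidence lower bound and the value function as one-state expectations *)

Section bellman.
Context {R : realType} {dx dth : nat} {dY : measure_display}
        {Y : measurableType dY} {nu : {measure set Y -> \bar R}}.
Context (M : state_space_model dx dth nu) (q : variational_family R dx)
        (y : nat -> Y).
Hypothesis reg : regular M q y.
Local Notation leb := (lebesgue_euclidean R dx).

Let pos : positive_densities M q := regular_positive reg.

Lemma ELBO_expect_value n theta :
  ELBO M q y n.+1 theta = expect leb (vf_marginal q n.+1) (value M q y n.+1 theta).
Proof.
have [pI _ _ _] := regular_path reg (t := n.+1) isT theta.
(* Finiteness of the conditional expectation for every [x] supplies the slice integrability for
   Fubini. *)
have vI x : expect_finite _ _ _ :=
  let: And4 h _ _ _ := regular_value reg (t := n.+1) x isT theta in h.
have pathE x (w : n.-tuple (euclidean R dx)) :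
  path_density q n.+1 (trajectory (rcons w x)) =
  vf_marginal q n.+1 x * backward_density q n.+1 (trajectory (rcons w x)).
  by rewrite /path_density trajectory_last// size_tuple.
rewrite /ELBO /expect Rintegral_rcons_measure//; last first.
  move=> x; have := integrableZl measurableT (vf_marginal q n.+1 x) (vI x).
  by apply: eq_integrable => // w _; rewrite pathE -mulrA EFinM.
apply: eq_Rintegral => x _; rewrite /value /expect -RintegralZl//; last exact: vI.
by apply: eq_Rintegral => w _; rewrite pathE mulrA.
Qed.

Lemma value_recr n theta x' :
  value M q y n.+2 theta x' =
  expect leb (vf_backward q n.+2 ^~ x')
    (fun x => value M q y n.+1 theta x + reward M q y n.+1 theta x x').
Proof.
have [pI _ _ _] := regular_value reg (t := n.+2) x' isT theta.
have vI x : expect_finite _ _ _ :=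
  let: And4 h _ _ _ := regular_value reg (t := n.+1) x isT theta in h.
pose B x (w : n.-tuple (euclidean R dx)) :=
  backward_density q n.+1 (trajectory (rcons w x)).
pose L x (w : n.-tuple (euclidean R dx)) :=
  log_ratio M q y theta n.+1 (trajectory (rcons w x)).
pose r x := reward M q y n.+1 theta x x'.
(* The reward does not depend on [w], so it only scales a density of mass 1. *)
have rI x : (path_measure n).-integrable [set: _] (fun w => (r x * B x w)%:E).
  under eq_fun do rewrite EFinM.
  by apply: integrableZl => //; exact: (integrable_backward_density _ _ pos).
have vrI x : (path_measure n).-integrable [set: _]
    (fun w => (B x w * L x w + r x * B x w)%:E).
  under eq_fun do rewrite EFinD.
  by apply: integrableD => //; exact: vI.
(* Given [x], the kernel factor is constant in [w]; [B * L] will integrate to the value at [x] and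
   [r * B] to the reward. *)
have stepE x (w : n.-tuple (euclidean R dx)) : backward_density q n.+2 (trajectory (rcons (rcons w x) x')) *
    log_ratio M q y theta n.+2 (trajectory (rcons (rcons w x) x')) =
    vf_backward q n.+2 x x' * (B x w * L x w + r x * B x w).
  by rewrite backward_density_rcons (log_ratio_rcons _ _ _ pos) -mulrA mulrDr
    [r x * _]mulrC.
rewrite /value /expect Rintegral_rcons_measure//; last first.
  move=> x; have := integrableZl measurableT (vf_backward q n.+2 x x') (vrI x).
  by apply: eq_integrable => // w _; rewrite stepE EFinM.
apply: eq_Rintegral => x _; under eq_Rintegral do rewrite stepE.
rewrite RintegralZl//; last exact: vrI.
rewrite RintegralD//; last 2 first; [exact: vI|exact: rI|].
rewrite RintegralZl//; last exact: (integrable_backward_density _ _ pos).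
by rewrite [X in r x * X]/Rintegral (integral_backward_density _ _ pos) mulr1.
Qed.

End bellman.

Theorem proposition2 (R : realType) (dx dth : nat) (dY : measure_display)
    (Y : measurableType dY) (nu : {measure set Y -> \bar R})
    (M : state_space_model dx dth nu)
    (Phi : Type) (q : Phi -> variational_family R dx) (phi : Phi)
    (y : nat -> Y)
    (hreg : regular M (q phi) y) :
  [/\ forall t theta, (1 <= t)%N ->
        gradient (ELBO M (q phi) y t) theta =
        expect_vec (lebesgue_euclidean R dx) (vf_marginal (q phi) t)
          (value_gradient M (q phi) y t theta),
      forall t theta x x', (1 <= t)%N ->
        reward_gradient M (q phi) y t theta x x' =
        gradient (fun theta' =>
          ln (ssm_trans M theta' x' x * ssm_obs M theta' (y t.+1) x')) theta &
      forall t theta x', (1 <= t)%N ->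
        value_gradient M (q phi) y t.+1 theta x' =
        expect_vec (lebesgue_euclidean R dx)
          (fun x => vf_backward (q phi) t.+1 x x')
          (fun x => value_gradient M (q phi) y t theta x +
                    reward_gradient M (q phi) y t theta x x')].

Proof.
have pos := regular_positive hreg.
split.
- move=> [//|n] theta _.
  (* The interchange turns the right-hand side into a gradient, leaving an equality of functions of
     the parameter. *)
  have [_ _ _ <-] := regular_marginal hreg (t := n.+1) isT theta.
  congr (gradient _ theta); apply/funext => theta'.
  exact: ELBO_expect_value.
- move=> [//|n] theta x x' _; have [_ f0 g0 _ _] := pos.
  rewrite /reward_gradient.
  (* The added constant is the contribution of the denominator of the reward, which is free of
     [theta]. *)
  rewrite -[RHS](gradient_addr_cst _ _ _ (- ln (forward_kernel (q phi) n.+1 x' x))).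
  congr (gradient _ theta); apply/funext => theta'.
  by rewrite /reward ln_div// posrE ?(forward_kernel_gt0 _ _ pos) ?mulr_gt0.
- move=> [//|n] theta x' _.
  have [_ vfin vder vgrad] :=
    regular_backward_value hreg (t := n.+1) x' isT theta.
  have [_ rfin rder rgrad] :=
    regular_backward_reward hreg (t := n.+1) x' isT theta.
  (* Two interchanges under the same kernel gather the right-hand side into one gradient. *)
  rewrite expect_vecD// -vgrad -rgrad -gradientD//.
  congr (gradient _ theta); apply/funext => theta'.
  (* The Bellman recursion must hold at every [theta'], so finiteness is taken there and not only at
     [theta]. *)
  have [vI _ _ _] := regular_backward_value hreg (t := n.+1) x' isT theta'.
  have [rI _ _ _] := regular_backward_reward hreg (t := n.+1) x' isT theta'.
  by rewrite value_recr// expectD.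
Qed.
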